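(* Let $n,N\ge 1$, $T>0$, $\mathbf c\in\mathbb R^n_+$, $\mathbf d\in\mathbb R^n_+$, $C\ge 0$ with $d_{i+1}-d_i\le c_{i+1}$ for all $i\in[n-1]$. Suppose the support set $\mathcal U\subseteq\mathbb R^n$ is nonempty, compact and convex, let $\widehat{\mathbf u}^1,\dots,\widehat{\mathbf u}^N\in\mathcal U$ and $\epsilon>0$. (i) If $p=1$, then problem W-DRAS has optimal value $$\widehat Z(N,\epsilon)=\inf\Big\{\epsilon\rho+\tfrac1N\sum_{j=1}^N\beta_j:\ \rho\in\mathbb R,\ \boldsymbol\beta\in\mathbb R^N,\ \mathbf s\in\mathcal S,\ \rho\ge 0,\ \beta_j\mathbf e_1\mathbf e_1^\top-\mathbf H^1_j(\rho,\mathbf s)\in\mathcal{COP}(\mathcal K_1^j)\ \forall j\in[N]\Big\},$$ where $\mathbf e_1$ is the first standard basis vector of $\mathbb R^{3n+1}$, and W-DRAS and this program have the same set of optimal solutions $\mathbf s$. (ii) If $p=2$, then $$\widehat Z(N,\epsilon)=\inf\Big\{\epsilon^2\rho+\tfrac1N\sum_{j=1}^N\beta_j:\ \rho\in\mathbb R,\ \boldsymbol\beta\in\mathbb R^N,\ \mathbf s\in\mathcal S,\ \rho\ge 0,\ \beta_j\mathbf e_1\mathbf e_1^\top-\mathbf H^2_j(\rho,\mathbf s)\in\mathcal{COP}(\mathcal K_2)\ \forall j\in[N]\Big\},$$ where $\mathbf e_1$ is the first standard basis vector of $\mathbb R^{2n+1}$, and W-DRAS and this program have the same set of optimal solutions $\mathbf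 s$.
   Context: Notation: $[m]=\{1,\dots,m\}$, $[i,j]_{\mathbb Z}=\{i,\dots,j\}$; $\mathbf e$ is the all-ones vector and $\mathbf I$ the identity in the appropriate dimension; $\mathbb S^k$ denotes symmetric $k\times k$ matrices. The feasible schedules are $\mathcal S=\{\mathbf s\in\mathbb R^n:\mathbf s\ge 0,\ \sum_i s_i\le T\}$. For $\mathbf s\in\mathcal S$ and $\mathbf u\in\mathbb R^n$, $f(\mathbf s,\mathbf u)$ is the optimal value of the linear program $\min_{\mathbf w\in\mathbb R^{n+1},\mathbf v\in\mathbb R^n}\sum_{i=1}^n(c_iw_i+d_iv_i)+Cw_{n+1}$ s.t. $w_i-v_{i-1}=u_{i-1}+w_{i-1}-s_{i-1}$ for $i\in[2,n+1]_{\mathbb Z}$, $\mathbf w\ge0$, $w_1=0$, $\mathbf v\ge0$. For $p\ge1$ and distributions $\mathbb Q_1,\mathbb Q_2$ on $\mathcal U$, the Wasserstein distance is $d_p(\mathbb Q_1,\mathbb Q_2)=\big(\inf_{\Pi}\mathbb E_\Pi[\|\mathbf u_1-\mathbf u_2\|_p^p]\big)^{1/p}$, infimum over joint distributions $\Pi$ of $(\mathbf u_1,\mathbf u_2)$ with marginals $\mathbb Q_1,\mathbb Q_2$. With $\widehat{\mathbb P}^N=\frac1N\sum_{j}\delta_{\widehat{\mathbf u}^j}$, the ambiguity set is $\mathcal D_p(\widehat{\mathbb P}^N,\epsilon)=\{\mathbb Q$ probability distribution on $\mathcal U: d_p(\mathbb Q,\widehat{\mathbb P}^N)\le\epsilon\}$,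 and W-DRAS is the problem $\widehat Z(N,\epsilon)=\min_{\mathbf s\in\mathcal S}\sup_{\mathbb Q\in\mathcal D_p(\widehat{\mathbb P}^N,\epsilon)}\mathbb E_{\mathbb Q}[f(\mathbf s,\mathbf u)]$. Let $\mathcal Y=\{\mathbf y\in\mathbb R^n: -y_i\le d_i\ \forall i\in[n];\ y_{i-1}-y_i\le c_i\ \forall i\in[2,n]_{\mathbb Z};\ y_n\le C\}$. Define $\mathcal F_1^j=\{(\mathbf u^+,\mathbf u^-,\mathbf y)\in\mathbb R^n_+\times\mathbb R^n_+\times\mathbb R^n:\mathbf u^+-\mathbf u^-+\widehat{\mathbf u}^j\in\mathcal U,\ \mathbf y\in\mathcal Y\}$ and $\mathcal F_2=\{(\mathbf u,\mathbf y)\in\mathbb R^n\times\mathbb R^n:\mathbf u\in\mathcal U,\mathbf y\in\mathcal Y\}$, and their perspective cones $\mathcal K_1^j=\mathrm{closure}\{(t,\mathbf u^+,\mathbf u^-,\mathbf y):(\mathbf u^+/t,\mathbf u^-/t,\mathbf y/t)\in\mathcal F_1^j,\ t>0\}\subseteq\mathbb R^{3n+1}$ and $\mathcal K_2=\mathrm{closure}\{(t,\mathbf u,\mathbf y):(\mathbf u/t,\mathbf y/t)\in\mathcal F_2,\ t>0\}\subseteq\mathbb R^{2n+1}$. For a closed convex cone $\mathcal K\subseteq\mathbb R^k$, $\mathcal{COP}(\mathcal K)=\{\mathbf M\in\mathbb S^k:\mathbf x^\top\mathbf M\mathbf x\ge0\ \forall\mathbf x\in\mathcal K\}$. For $\rho\in\mathbb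 R$, $\mathbf s\in\mathbb R^n$, define the block matrices (block sizes $1,n,n,n$ resp. $1,n,n$) $$\mathbf H^1_j(\rho,\mathbf s)=\begin{bmatrix}0&-\tfrac12\rho\mathbf e^\top&-\tfrac12\rho\mathbf e^\top&\tfrac12(\widehat{\mathbf u}^j-\mathbf s)^\top\\-\tfrac12\rho\mathbf e&0&0&\tfrac12\mathbf I\\-\tfrac12\rho\mathbf e&0&0&-\tfrac12\mathbf I\\\tfrac12(\widehat{\mathbf u}^j-\mathbf s)&\tfrac12\mathbf I&-\tfrac12\mathbf I&0\end{bmatrix},\quad \mathbf H^2_j(\rho,\mathbf s)=\begin{bmatrix}-\rho\|\widehat{\mathbf u}^j\|_2^2&\rho(\widehat{\mathbf u}^j)^\top&-\tfrac12\mathbf s^\top\\\rho\widehat{\mathbf u}^j&-\rho\mathbf I&\tfrac12\mathbf I\\-\tfrac12\mathbf s&\tfrac12\mathbf I&0\end{bmatrix}.$$ *)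

(* Defs.v *)
From HB Require Import structures.
From mathcomp Require Import all_boot all_order all_algebra.
From mathcomp Require Import all_classical all_reals all_analysis.
Set Implicit Arguments.
Unset Strict Implicit.
Unset Printing Implicit Defensive.
Import Order.TTheory GRing.Theory Num.Theory.
Import numFieldTopology.Exports numFieldNormedType.Exports.
Local Open Scope classical_set_scope.
Local Open Scope ring_scope.

(* Vectors of R^n are column vectors 'cV[R]_n; the i-th coordinate is x i 0
   (0-indexed: paper index i+1). *)

Definition Rn (R : realType) (n : nat) :=
  g_sigma_algebraType (@open [the topologicalType of 'M[R]_(n, 1)]).

Definition Sched (R : realType) (n : nat) (T : R) : set 'cV[R]_n :=
  [set s | (forall i, 0 <= s i 0) /\ \sum_(i < n) s i 0 <= T].

(* Feasibility for the recourse LP defining f(s,u).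
   w : R^(n+1) indexed by 'I_(n.+1) (paper w_{k+1} is w k),
   v : R^n.  Paper constraint for i in [2,n+1] (j = i-2 here):
   w_i - v_{i-1} = u_{i-1} + w_{i-1} - s_{i-1}. *)
Definition lp_feas (R : realType) (n : nat) (s u : 'cV[R]_n)
    (w : 'cV[R]_n.+1) (v : 'cV[R]_n) : Prop :=
  (forall j : 'I_n,
     w (lift ord0 j) 0 - v j 0 = u j 0 + w (widen_ord (leqnSn n) j) 0 - s j 0)
  /\ (forall k, 0 <= w k 0) /\ w ord0 0 = 0 /\ (forall j, 0 <= v j 0).

Definition lp_obj (R : realType) (n : nat) (c d : 'cV[R]_n) (C : R)
    (w : 'cV[R]_n.+1) (v : 'cV[R]_n) : R :=
  \sum_(j < n) (c j 0 * w (widen_ord (leqnSn n) j) 0 + d j 0 * v j 0)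
  + C * w ord_max 0.

Definition fval (R : realType) (n : nat) (c d : 'cV[R]_n) (C : R)
    (s u : 'cV[R]_n) : \bar R :=
  ereal_inf [set r | exists w v, lp_feas s u w v /\ r = (lp_obj c d C w v)%:E].

Definition lpnorm (R : realType) (n : nat) (p : R) (x : 'cV[R]_n) : R :=
  (\sum_(i < n) `|x i 0| `^ p) `^ p^-1.

Definition coupling (R : realType) (n : nat)
    (mu1 mu2 : set (Rn R n) -> \bar R) (Pi : probability (Rn R n * Rn R n)%type R) :=
  forall A : set (Rn R n), measurable A ->
    Pi (A `*` setT) = mu1 A /\ Pi (setT `*` A) = mu2 A.

Definition wass (R : realType) (n : nat) (p : R)
    (mu1 mu2 : set (Rn R n) -> \bar R) : \bar R :=
  poweR (ereal_inf [set (\int[Pi]_z ((lpnorm p ((z.1 : 'cV[R]_n) - z.2)) `^ p)%:E)%E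
                   | Pi in coupling mu1 mu2]) p^-1.

Definition empirical (R : realType) (n N : nat) (uh : 'I_N -> 'cV[R]_n)
    (A : set (Rn R n)) : \bar R :=
  ((N%:R^-1)%:E * \sum_(j < N) \d_(uh j : Rn R n) A)%E.

Definition ambiguity (R : realType) (n N : nat) (p eps : R) (U : set 'cV[R]_n)
    (uh : 'I_N -> 'cV[R]_n) : set (probability (Rn R n) R) :=
  [set Q | Q U = 1%E /\ (wass p Q (empirical uh) <= eps%:E)%E].

Definition worst (R : realType) (n N : nat) (p eps : R) (c d : 'cV[R]_n) (C : R)
    (U : set 'cV[R]_n) (uh : 'I_N -> 'cV[R]_n) (s : 'cV[R]_n) : \bar R :=
  ereal_sup [set (\int[Q]_u fval c d C s u)%E | Q in ambiguity p eps U uh].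

Definition Zhat (R : realType) (n N : nat) (p eps T : R) (c d : 'cV[R]_n) (C : R)
    (U : set 'cV[R]_n) (uh : 'I_N -> 'cV[R]_n) : \bar R :=
  ereal_inf [set worst p eps c d C U uh s | s in Sched T].

Definition wdras_opt (R : realType) (n N : nat) (p eps T : R) (c d : 'cV[R]_n) (C : R)
    (U : set 'cV[R]_n) (uh : 'I_N -> 'cV[R]_n) (s : 'cV[R]_n) : Prop :=
  Sched T s /\ worst p eps c d C U uh s = Zhat p eps T c d C U uh.

Definition Yset (R : realType) (n : nat) (c d : 'cV[R]_n) (C : R) : set 'cV[R]_n :=
  [set y | (forall i, - y i 0 <= d i 0)
         /\ (forall i j : 'I_n, j = i.+1 :> nat -> y i 0 - y j 0 <= c j 0)
         /\ (forall i : 'I_n, i.+1 = n -> y i 0 <= C)].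

Definition F1 (R : realType) (n : nat) (c d : 'cV[R]_n) (C : R) (U : set 'cV[R]_n)
    (uhj : 'cV[R]_n) (up um y : 'cV[R]_n) : Prop :=
  (forall i, 0 <= up i 0) /\ (forall i, 0 <= um i 0) /\ U (up - um + uhj)
  /\ Yset c d C y.

Definition F2 (R : realType) (n : nat) (c d : 'cV[R]_n) (C : R) (U : set 'cV[R]_n)
    (u y : 'cV[R]_n) : Prop :=
  U u /\ Yset c d C y.

Definition K1 (R : realType) (n : nat) (c d : 'cV[R]_n) (C : R) (U : set 'cV[R]_n)
    (uhj : 'cV[R]_n) : set 'cV[R]_(1 + (n + n + n)) :=
  closure [set x | exists (t : R) (up um y : 'cV[R]_n),
     x = col_mx t%:M (col_mx (col_mx up um) y) /\ 0 < t
     /\ F1 c d C U uhj (t^-1 *: up) (t^-1 *: um) (t^-1 *: y)].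

Definition K2 (R : realType) (n : nat) (c d : 'cV[R]_n) (C : R) (U : set 'cV[R]_n)
    : set 'cV[R]_(1 + (n + n)) :=
  closure [set x | exists (t : R) (u y : 'cV[R]_n),
     x = col_mx t%:M (col_mx u y) /\ 0 < t /\ F2 c d C U (t^-1 *: u) (t^-1 *: y)].

Definition COP (R : realType) (k : nat) (K : set 'cV[R]_k) : set 'M[R]_k :=
  [set M | M^T = M /\ forall x, K x -> 0 <= (x^T *m M *m x) 0 0].

Definition e1 (R : realType) (k : nat) : 'cV[R]_(1 + k) :=
  delta_mx (lshift k (ord0 : 'I_1)) 0.

Definition H1 (R : realType) (n : nat) (uhj : 'cV[R]_n) (rho : R) (s : 'cV[R]_n)
    : 'M[R]_(1 + (n + n + n)) :=
  let e : 'cV[R]_n := const_mx 1 in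
  block_mx (0 : 'M[R]_1)
    (row_mx (row_mx (- (2^-1 * rho) *: e^T) (- (2^-1 * rho) *: e^T))
            (2^-1 *: (uhj - s)^T))
    (col_mx (col_mx (- (2^-1 * rho) *: e) (- (2^-1 * rho) *: e))
            (2^-1 *: (uhj - s)))
    (block_mx (0 : 'M[R]_(n + n))
              (col_mx (2^-1 *: (1%:M : 'M[R]_n)) (- 2^-1 *: (1%:M : 'M[R]_n)))
              (row_mx (2^-1 *: (1%:M : 'M[R]_n)) (- 2^-1 *: (1%:M : 'M[R]_n)))
              (0 : 'M[R]_n)).

Definition H2 (R : realType) (n : nat) (uhj : 'cV[R]_n) (rho : R) (s : 'cV[R]_n)
    : 'M[R]_(1 + (n + n)) :=
  block_mx ((- rho * \sum_(i < n) uhj i 0 ^+ 2)%:M : 'M[R]_1)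
    (row_mx (rho *: uhj^T) (- 2^-1 *: s^T))
    (col_mx (rho *: uhj) (- 2^-1 *: s))
    (block_mx (- rho *: (1%:M : 'M[R]_n)) (2^-1 *: (1%:M : 'M[R]_n))
              (2^-1 *: (1%:M : 'M[R]_n)) (0 : 'M[R]_n)).

Definition prog1_feas (R : realType) (n N : nat) (T : R) (c d : 'cV[R]_n) (C : R)
    (U : set 'cV[R]_n) (uh : 'I_N -> 'cV[R]_n)
    (rho : R) (beta : 'I_N -> R) (s : 'cV[R]_n) : Prop :=
  Sched T s /\ 0 <= rho /\
  forall j : 'I_N,
    COP (K1 c d C U (uh j)) (beta j *: (e1 R (n + n + n) *m (e1 R (n + n + n))^T)
                             - H1 (uh j) rho s).

Definition prog1_obj (R : realType) (N : nat) (eps rho : R) (beta : 'I_N -> R) : R :=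
  eps * rho + N%:R^-1 * \sum_(j < N) beta j.

Definition prog1_val (R : realType) (n N : nat) (eps T : R) (c d : 'cV[R]_n) (C : R)
    (U : set 'cV[R]_n) (uh : 'I_N -> 'cV[R]_n) : \bar R :=
  ereal_inf [set r | exists rho beta s,
     prog1_feas T c d C U uh rho beta s /\ r = (prog1_obj eps rho beta)%:E].

Definition prog1_opt (R : realType) (n N : nat) (eps T : R) (c d : 'cV[R]_n) (C : R)
    (U : set 'cV[R]_n) (uh : 'I_N -> 'cV[R]_n) (s : 'cV[R]_n) : Prop :=
  exists rho beta, prog1_feas T c d C U uh rho beta s /\
    (prog1_obj eps rho beta)%:E = prog1_val eps T c d C U uh.

Definition prog2_feas (R : realType) (n N : nat) (T : R) (c d : 'cV[R]_n) (C : R)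
    (U : set 'cV[R]_n) (uh : 'I_N -> 'cV[R]_n)
    (rho : R) (beta : 'I_N -> R) (s : 'cV[R]_n) : Prop :=
  Sched T s /\ 0 <= rho /\
  forall j : 'I_N,
    COP (K2 c d C U) (beta j *: (e1 R (n + n) *m (e1 R (n + n))^T) - H2 (uh j) rho s).

Definition prog2_obj (R : realType) (N : nat) (eps rho : R) (beta : 'I_N -> R) : R :=
  eps ^+ 2 * rho + N%:R^-1 * \sum_(j < N) beta j.

Definition prog2_val (R : realType) (n N : nat) (eps T : R) (c d : 'cV[R]_n) (C : R)
    (U : set 'cV[R]_n) (uh : 'I_N -> 'cV[R]_n) : \bar R :=
  ereal_inf [set r | exists rho beta s,
     prog2_feas T c d C U uh rho beta s /\ r = (prog2_obj eps rho beta)%:E].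

Definition prog2_opt (R : realType) (n N : nat) (eps T : R) (c d : 'cV[R]_n) (C : R)
    (U : set 'cV[R]_n) (uh : 'I_N -> 'cV[R]_n) (s : 'cV[R]_n) : Prop :=
  exists rho beta, prog2_feas T c d C U uh rho beta s /\
    (prog2_obj eps rho beta)%:E = prog2_val eps T c d C U uh.

(* Main.v *)
Require Import Defs.
From HB Require Import structures.
From mathcomp Require Import all_boot all_order all_algebra.
From mathcomp Require Import all_classical all_reals all_analysis.
From mathcomp Require Import measurable_realfun zify ring lra.
Set Implicit Arguments.
Unset Strict Implicit.
Unset Printing Implicit Defensive.
Import Order.TTheory GRing.Theory Num.Theory.
Import numFieldTopology.Exports numFieldNormedType.Exports.
Local Open Scope classical_set_scope.
Local Open Scope ring_scope.

(** The recourse program is solved by the waiting-time recursion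
    [w_{k+1} = max(0, w_k + u_k - s_k)], and complementary slackness yields a
    dual solution in [Y], so [f(s,u)] is the maximum of [(u - s)^T y] over [Y].
    A coupling bounds the worst-case expectation by [eps^p rho + mean beta]
    whenever [f(s,u) <= beta_j + rho |u - uh_j|_p^p] on [U].  Conversely, among
    the pairs (mean cost, mean value) of choices of one atom per sample, mixing a
    choice that costs more than [eps^p] with one that costs less never beats the
    worst case; this says exactly that a single slope [rho] separates the two
    kinds of choices, so the bound is attained.  Finally the copositivity
    constraint is the inequality on [f], homogenised and closed. *)

(** * The recourse linear program *)

Section Recourse.
Variables (R : realType) (n : nat).
Implicit Types (s u y c d v : 'cV[R]_n) (w : 'cV[R]_n.+1).

Definition dot (x y : 'cV[R]_n) : R := \sum_(i < n) x i 0 * y i 0.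

(** Reading coordinates by a natural number lets the waiting times be defined by plain recursion.
    The default 0 is never met for [wait s u k] with k at most n. *)
Definition entry u (k : nat) : R := if insub k is Some i then u i 0 else 0.

Lemma entryE u (i : 'I_n) : entry u i = u i 0.
Proof. by rewrite /entry valK. Qed.

Fixpoint wait s u (k : nat) : R :=
  if k is k'.+1 then Num.max 0 (wait s u k' + (entry u k' - entry s k')) else 0.

Definition greedy_w s u : 'cV[R]_n.+1 := \col_(k < n.+1) wait s u k.

Definition greedy_v s u : 'cV[R]_n :=
  \col_(k < n) (wait s u k.+1 - (wait s u k + (u k 0 - s k 0))).

Definition fopt c d (C : R) s u : R := lp_obj c d C (greedy_w s u) (greedy_v s u).

Lemma wait_ge0 s u k : 0 <= wait s u k.
Proof. by case: k => //= k; rewrite le_max lexx. Qed.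

Lemma greedy_feas s u : lp_feas s u (greedy_w s u) (greedy_v s u).
Proof.
split; [|split; [|split]].
- by move=> j; rewrite !mxE lift0 /=; ring.
- by move=> k; rewrite mxE wait_ge0.
- by rewrite mxE.
- by move=> j; rewrite mxE subr_ge0 /= !entryE le_max lexx orbT.
Qed.

(* [Yset] bounds y_{k-1} by [dual_cap k]. *)
Definition dual_cap c (C : R) y (k : 'I_n.+1) : R :=
  if unlift ord_max k is Some j then c j 0 + y j 0 else C.

(** The duality gap, for an arbitrary [y], is a sum of complementary slackness products. Weak
    duality is then a sign check on the factors, and optimality amounts to one factor of each
    product being zero. *)
Lemma lp_gap c d C s u w v y : lp_feas s u w v ->
  lp_obj c d C w v - dot (u - s) y =
  \sum_(j < n) v j 0 * (d j 0 + y j 0) +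
  \sum_(j < n) w (lift ord0 j) 0 * (dual_cap c C y (lift ord0 j) - y j 0).
Proof.
move=> [wE [_ [w0 _]]].
have capS j : dual_cap c C y (widen_ord (leqnSn n) j) = c j 0 + y j 0.
  have -> : widen_ord (leqnSn n) j = lift ord_max j.
    by apply: val_inj; rewrite /= /bump leqNgt ltn_ord.
  by rewrite /dual_cap liftK.
have capM : dual_cap c C y ord_max = C by rewrite /dual_cap unlift_none.
(* As [w ord0 0 = 0], the first term can be added for free; splitting off the last one instead
   produces the terminal cost [C]. *)
have shift : \sum_(j < n) w (lift ord0 j) 0 * dual_cap c C y (lift ord0 j) =
    \sum_(j < n) w (widen_ord (leqnSn n) j) 0 * (c j 0 + y j 0) + C * w ord_max 0.
  transitivity (\sum_(k < n.+1) w k 0 * dual_cap c C y k).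
    by rewrite big_ord_recl w0 mul0r add0r.
  rewrite big_ord_recr /= capM mulrC; congr (_ + _).
  by apply: eq_bigr => j _; rewrite capS.
under [X in _ = _ + X]eq_bigr do rewrite mulrBr.
rewrite big_split /= shift sumrN /lp_obj /dot.
have key : \sum_(j < n) (c j 0 * w (widen_ord (leqnSn n) j) 0 + d j 0 * v j 0)
    - \sum_(j < n) (u - s) j 0 * y j 0 =
    \sum_(j < n) v j 0 * (d j 0 + y j 0)
    + \sum_(j < n) w (widen_ord (leqnSn n) j) 0 * (c j 0 + y j 0)
    - \sum_(j < n) w (lift ord0 j) 0 * y j 0.
  rewrite -sumrB -big_split -sumrB /=; apply: eq_bigr => j _; rewrite !mxE.
  have -> : u j 0 - s j 0 =
    w (lift ord0 j) 0 - v j 0 - w (widen_ord (leqnSn n) j) 0.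
    by rewrite wE; ring.
  ring.
lra.
Qed.

Lemma Yset_cap c d C y j : Yset c d C y ->
  y j 0 <= dual_cap c C y (lift ord0 j).
Proof.
move=> [_ [yc yC]]; rewrite /dual_cap; case: unliftP => [k|] jE.
  rewrite -lerBlDr; apply: yc.
  by move/(congr1 (@nat_of_ord _)): jE; rewrite lift0 /= /bump leqNgt ltn_ord => ->.
by apply: yC; move/(congr1 (@nat_of_ord _)): jE; rewrite lift0.
Qed.

Lemma lp_weak c d C s u w v y : Yset c d C y -> lp_feas s u w v ->
  dot (u - s) y <= lp_obj c d C w v.
Proof.
move=> Yy wv; rewrite -subr_ge0 (lp_gap c d C y wv).
have [_ [w0 [_ v0]]] := wv; have [yd _] := Yy.
apply: addr_ge0; apply: sumr_ge0 => j _; apply: mulr_ge0 => //.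
  by have := yd j; lra.
by rewrite subr_ge0 (Yset_cap j Yy).
Qed.

(** The dual vector puts each coordinate at its cap where the next waiting time is positive and at
    its lower bound [- d] elsewhere. The growth condition on [d] ensures that no cap lies below the
    lower bound. *)
Lemma lp_strong c d C s u :
  (forall i, 0 <= c i 0) -> (forall i, 0 <= d i 0) -> 0 <= C ->
  (forall i j : 'I_n, j = i.+1 :> nat -> d j 0 - d i 0 <= c j 0) ->
  exists y, Yset c d C y /\ dot (u - s) y = fopt c d C s u.
Proof.
move=> c0 d0 C0 cd.
(* [yrev m] is y_{n-1-m}: the dual solution is forced, backwards from the last
   coordinate, by complementary slackness with the greedy primal solution. *)
pose yrev := fix g m : R := let k := (n.-1 - m)%N in
  if 0 < wait s u k.+1 then
    (if m is m'.+1 then g m' + entry c k.+1 else C) else - entry d k.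
(* At a cap, -d_k <= c_{k+1} - d_{k+1} <= c_{k+1} + y_{k+1}: the first inequality is the growth
   condition, the second the induction hypothesis. *)
have yrev_ge m : (m < n)%N -> - entry d (n.-1 - m) <= yrev m.
  elim: m => [|m IH] mn /=; case: ifP => // _.
    have k1 : (n.-1 < n)%N by lia.
    by rewrite subn0 [entry d _](entryE d (Ordinal k1)) (le_trans _ C0) // oppr_le0.
  have k1 : (n.-1 - m.+1 < n)%N by lia.
  have k2 : (n.-1 - m < n)%N by lia.
  have E : (n.-1 - m = (n.-1 - m.+1).+1)%N by lia.
  have := IH (ltnW mn); rewrite -E.
  rewrite [entry d (n.-1 - m.+1)](entryE d (Ordinal k1)).
  rewrite [entry d (n.-1 - m)](entryE d (Ordinal k2)) [entry c _](entryE c (Ordinal k2)).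
  by have := cd (Ordinal k1) (Ordinal k2) E; lra.
pose y : 'cV[R]_n := \col_(i < n) yrev (n.-1 - i)%N.
have Yy : Yset c d C y.
  split; [|split].
  - move=> i; rewrite mxE lerNl.
    have := yrev_ge (n.-1 - i)%N; have := ltn_ord i => ilt.
    by rewrite (_ : (n.-1 - (n.-1 - i) = i)%N) ?entryE; [apply|]; lia.
  - move=> i j ji; rewrite !mxE.
    have jn := ltn_ord j.
    have Em : (n.-1 - i = (n.-1 - j).+1)%N by lia.
    have := yrev_ge (n.-1 - j)%N; rewrite (_ : (n.-1 - (n.-1 - j) = j)%N); last by lia.
    rewrite entryE Em /= (_ : (n.-1 - (n.-1 - j).+1 = i)%N); last by lia.
    have := cd i j ji; case: ifP => _; rewrite -?ji ?entryE; last first.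
      by move=> h1 h2; have := h2 ltac:(lia); lra.
    by lra.
  - move=> i iN; rewrite mxE (_ : (n.-1 - i = 0)%N); last by lia.
    rewrite /= subn0; case: ifP => // _; rewrite (_ : n.-1 = i); last by lia.
    by rewrite entryE (le_trans _ C0) // oppr_le0.
exists y; split => //; apply/eqP; rewrite eq_sym -subr_eq0.
rewrite (lp_gap c d C y (greedy_feas s u)).
have yE (j : 'I_n) : y j 0 = if 0 < wait s u j.+1 then dual_cap c C y (lift ord0 j)
   else - d j 0.
  have jn := ltn_ord j.
  rewrite mxE; case E : (n.-1 - j)%N => [|m] /=.
    rewrite subn0 (_ : n.-1 = j); last by lia.
    case: ifP => _; last by rewrite entryE.
    rewrite /dual_cap; case: unliftP => [k|] // /(congr1 (@nat_of_ord _)).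
    rewrite lift0 /= /bump leqNgt ltn_ord /=.
    move=> jk; exfalso; have := ltn_ord k; rewrite -[X in (X < _)%N]add0n -jk /=; lia.
  have -> : (n.-1 - m.+1 = j)%N by lia.
  case: ifP => _; last by rewrite entryE.
  rewrite /dual_cap; case: unliftP => [k|] /(congr1 (@nat_of_ord _)); rewrite lift0 /=; last by lia.
  rewrite /bump leqNgt ltn_ord /= add0n => jk.
  by rewrite jk entryE mxE addrC; congr (_ + yrev _); lia.
(* If the waiting time after j is positive, the cap is tight and the idle time is 0, the maximum
   being its second argument. Otherwise that waiting time is 0 and y_j = -d_j. *)
rewrite !big1 ?addr0 // => j _; rewrite mxE ?lift0 yE; case: ifP => h.
- by rewrite subrr mulr0.
- have /eqP -> : wait s u j.+1 == 0 by rewrite eq_le wait_ge0 andbT leNgt h.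
  by rewrite mul0r.
- have -> : wait s u j.+1 - (wait s u j + (u j 0 - s j 0)) = 0; last by rewrite mul0r.
  move: h; rewrite /= !entryE; case: (leP 0 (wait s u j + (u j 0 - s j 0))) => //.
    by rewrite subrr.
  by rewrite ltxx.
- by rewrite addrN mulr0.
Qed.
End Recourse.

Lemma fopt_ge0 (R : realType) (n : nat) (c d : 'cV[R]_n) (C : R) (s u : 'cV[R]_n) :
  (forall i, 0 <= c i 0) -> (forall i, 0 <= d i 0) -> 0 <= C ->
  0 <= fopt c d C s u.
Proof.
move=> c0 d0 C0; have [_ [w0 [_ v0]]] := greedy_feas s u.
apply: addr_ge0; last exact: mulr_ge0.
by apply: sumr_ge0 => j _; apply: addr_ge0; apply: mulr_ge0.
Qed.

Lemma fvalE (R : realType) (n : nat) (c d : 'cV[R]_n) (C : R) (s u : 'cV[R]_n) :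
  (forall i, 0 <= c i 0) -> (forall i, 0 <= d i 0) -> 0 <= C ->
  (forall i j : 'I_n, j = i.+1 :> nat -> d j 0 - d i 0 <= c j 0) ->
  fval c d C s u = (fopt c d C s u)%:E.
Proof.
move=> c0 d0 C0 cd; apply/eqP; rewrite eq_le; apply/andP; split.
  by apply: ereal_inf_lbound; exists (greedy_w s u), (greedy_v s u); split => //;
    exact: greedy_feas.
apply: le_ereal_inf_tmp => _ [w [v [wv ->]]]; rewrite lee_fin.
have [y [Yy <-]] := lp_strong s u c0 d0 C0 cd.
exact: lp_weak.
Qed.

(** * Continuity and measurability *)

Section RealContinuity.
Variables (R : realType) (V : topologicalType).
Implicit Types (f g : V -> R).

Lemma cont_add f g : continuous f -> continuous g -> continuous (fun x => f x + g x).
Proof. by move=> fc gc x; apply: continuousD; [exact: fc | exact: gc]. Qed.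

Lemma cont_sub f g : continuous f -> continuous g -> continuous (fun x => f x - g x).
Proof. by move=> fc gc x; apply: continuousB; [exact: fc | exact: gc]. Qed.

Lemma cont_mul f g : continuous f -> continuous g -> continuous (fun x => f x * g x).
Proof. by move=> fc gc x; apply: continuousM; [exact: fc | exact: gc]. Qed.

Lemma cont_const (a : R) : continuous (fun _ : V => a).
Proof. exact: cst_continuous. Qed.

Lemma cont_scale (a : R) f : continuous f -> continuous (fun x => a * f x).
Proof. by apply: cont_mul; exact: cont_const. Qed.

Lemma cont_max f g : continuous f -> continuous g ->
  continuous (fun x => Num.max (f x) (g x)).
Proof. by move=> fc gc x; apply: (@continuous_max R V f g x (fc x) (gc x)). Qed.

Lemma cont_sum (I : finType) (F : I -> V -> R) :
  (forall i, continuous (F i)) -> continuous (fun x => \sum_i F i x).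
Proof.
move=> Fc; elim: (index_enum I) => [|i r IH].
  by under eq_fun do rewrite big_nil; exact: cst_continuous.
by under eq_fun do rewrite big_cons; exact: cont_add.
Qed.
End RealContinuity.

Lemma entry_cont (R : realType) (n : nat) k : continuous (fun u : 'cV[R]_n => entry u k).
Proof.
rewrite /entry; case: insubP => [i _ _|_]; last exact: cst_continuous.
exact: coord_continuous.
Qed.

Lemma wait_cont (R : realType) (n : nat) (s : 'cV[R]_n) k :
  continuous (fun u => wait s u k).
Proof.
elim: k => [|k IH] /=; first exact: cont_const.
apply: cont_max; first exact: cont_const.
apply: cont_add => //; apply: cont_sub; [exact: entry_cont | exact: cont_const].
Qed.

(** The greedy solution is built from coordinates by sums, differences and maxima, so continuity
    needs no parametric theory of linear programs. *)
Lemma fopt_cont (R : realType) (n : nat) (c d : 'cV[R]_n) (C : R) (s : 'cV[R]_n) :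
  continuous (fopt c d C s).
Proof.
have wc k : continuous (fun u => greedy_w s u k 0).
  by under eq_fun do rewrite mxE; exact: wait_cont.
have vc k : continuous (fun u => greedy_v s u k 0).
  under eq_fun do rewrite mxE.
  apply: cont_sub; first exact: wait_cont.
  apply: cont_add; first exact: wait_cont.
  apply: cont_sub; [exact: coord_continuous | exact: cont_const].
rewrite -[fopt c d C s]/(fun u => lp_obj c d C (greedy_w s u) (greedy_v s u)) /lp_obj.
apply: cont_add; last exact: cont_scale.
by apply: cont_sum => j; apply: cont_add; exact: cont_scale.
Qed.

Lemma cont_Rn_measurable (R : realType) (n : nat) (g : 'cV[R]_n -> R) :
  continuous g -> measurable_fun [set: Rn R n] (g : Rn R n -> R).
Proof.
move=> /continuousP gc; apply: (measurability _ (RGenOpens.measurableE R)).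
move=> _ [_ [a [b ->] <-]]; rewrite setTI.
by apply: sub_sigma_algebra; apply: gc; exact: interval_open.
Qed.

Lemma closed_Rn_measurable (R : realType) (n : nat) (A : set 'cV[R]_n) :
  closed A -> measurable (A : set (Rn R n)).
Proof.
move=> cA; rewrite -[A]setCK; apply: measurableC.
by apply: sub_sigma_algebra; rewrite openC.
Qed.

Lemma set1_Rn_measurable (R : realType) (n : nat) (x : 'cV[R]_n) :
  measurable ([set x] : set (Rn R n)).
Proof.
apply: closed_Rn_measurable; apply: compact_closed; last exact: compact_set1.
exact: norm_hausdorff.
Qed.

Definition pcost (R : realType) (n : nat) (p : R) (x : 'cV[R]_n) : R :=
  \sum_(i < n) `|x i 0| `^ p.

Lemma pcost_ge0 (R : realType) (n : nat) (p : R) (x : 'cV[R]_n) : 0 <= pcost p x.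
Proof. by apply: sumr_ge0 => i _; exact: powR_ge0. Qed.

Lemma pcost0 (R : realType) (n : nat) (p : R) : p != 0 -> pcost p (0 : 'cV[R]_n) = 0.
Proof.
by move=> p0; rewrite /pcost big1 // => i _; rewrite mxE normr0 powR0.
Qed.

Lemma lpnormX (R : realType) (n : nat) (p : R) (x : 'cV[R]_n) :
  p != 0 -> lpnorm p x `^ p = pcost p x.
Proof. by move=> p0; rewrite /lpnorm -powRrM mulVf // powRr1 // pcost_ge0. Qed.

(** The pairs carry the product sigma-algebra, so measurability is assembled from the coordinates of
    each factor rather than deduced from joint continuity. *)
Lemma pcost_measurable (R : realType) (n : nat) (p : R) :
  measurable_fun [set: (Rn R n * Rn R n)%type]
    (fun z => pcost p ((z.1 : 'cV[R]_n) - z.2)).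
Proof.
apply: measurable_sum => i.
apply: (measurableT_comp (measurable_powR p)).
apply: (measurableT_comp (@normr_measurable R setT)).
under eq_fun do rewrite !mxE.
have coordM := cont_Rn_measurable (@coord_continuous R n 1 i 0).
apply: measurable_funB.
- exact: (measurableT_comp coordM measurable_fst).
- exact: (measurableT_comp coordM measurable_snd).
Qed.

(** * Wasserstein duality *)

(** A planar separation argument: the line through (delta, v) with slope [rho] must lie above all
    points (a k, b k). Points right of delta bound [rho] from below, points left of it from above,
    and mixing one of each shows the bounds compatible. The given point strictly left of delta keeps
    the slope finite. *)
Lemma supporting_slope (R : realType) (K : Type) (P : set K) (a b : K -> R) (delta v : R) :
  (exists2 k, P k & a k < delta) ->
  (forall k l (t : R), P k -> P l -> 0 <= t <= 1 ->
     t * a k + (1 - t) * a l <= delta -> t * b k + (1 - t) * b l <= v) ->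
  exists rho, 0 <= rho /\ forall k, P k -> b k <= v + rho * (a k - delta).
Proof.
move=> [k0 Pk0 ak0] mix.
have le_v k : P k -> a k <= delta -> b k <= v.
  by move=> Pk ak; have := mix k k 1 Pk Pk; rewrite !lexx ler01 /=; lra.
(* Slopes from (delta, v) to the points on its right; including 0 makes the set nonempty and its
   supremum nonnegative. *)
pose S : set R := [set 0] `|` [set (b k - v) / (a k - delta) | k in P `&` [set k | delta < a k]].
have Sub l : P l -> a l < delta -> ubound S ((v - b l) / (delta - a l)).
  move=> Pl al _ [->|[k [Pk ak] <-]].
    by rewrite divr_ge0 // subr_ge0 ?le_v // ltW.
  have ak' : 0 < a k - delta by rewrite subr_gt0.
  have al' : 0 < delta - a l by rewrite subr_gt0.
  rewrite ler_pdivrMr // mulrAC ler_pdivlMr //.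
  have D : 0 < a k - a l by lra.
  (* The weight for which the mixture of [k] and [l] costs exactly [delta]. *)
  pose t := (delta - a l) / (a k - a l).
  have t01 : 0 <= t <= 1.
    apply/andP; split; first by rewrite divr_ge0 // ltW.
    by rewrite ler_pdivrMr //; lra.
  have tE : t * (a k - a l) = delta - a l by rewrite divfK // gt_eqF.
  have := mix k l t Pk Pl t01.
  have -> : t * a k + (1 - t) * a l = delta.
    by rewrite -[RHS](subrK (a l)) -tE; ring.
  rewrite lexx => /(_ isT) /(ler_wpM2r (ltW D)).
  have -> : (t * b k + (1 - t) * b l) * (a k - a l) =
     (delta - a l) * (b k - b l) + b l * (a k - a l) by rewrite -tE; ring.
  nra.
have hS : has_sup S by split; [exists 0; left | exists ((v - b k0) / (delta - a k0)); exact: Sub].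
exists (sup S); split; first by apply: ub_le_sup; [exact: hS.2 | left].
move=> k Pk; case: (ltgtP (a k) delta) => ak.
- have : sup S <= (v - b k) / (delta - a k) by apply: ge_sup; [exact: hS.1 | exact: Sub].
  by rewrite ler_pdivlMr ?subr_gt0 //; lra.
- have : (b k - v) / (a k - delta) <= sup S.
    by apply: ub_le_sup; [exact: hS.2 | right; exists k].
  by rewrite ler_pdivrMr ?subr_gt0 //; lra.
- by rewrite ak subrr mulr0 addr0 le_v // ak.
Qed.

(** Independent choices let the supremum of a sum split into the sum of the suprema, which serve as
    [beta]. *)
Lemma separable_bound (R : realType) (I : finType) (X : Type) (U : set X)
    (g : I -> X -> R) (v : R) :
  U !=set0 -> (forall j, exists M, forall u, U u -> g j u <= M) ->
  (forall k : I -> X, (forall j, U (k j)) -> \sum_j g j (k j) <= v) ->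
  exists beta : I -> R, (forall j u, U u -> g j u <= beta j) /\ \sum_j beta j <= v.
Proof.
move=> [u0 Uu0] gM sumv.
have hS j : has_sup [set g j u | u in U].
  split; first by exists (g j u0), u0.
  by have [M HM] := gM j; exists M => _ [u Uu <-]; exact: HM.
exists (fun j => sup [set g j u | u in U]); split.
  by move=> j u Uu; apply: ub_le_sup; [exact: (hS j).2 | exists u].
apply/ler_addgt0Pr => e e0.
(* Each near-maximiser loses at most [e'], so the total loss is at most [e]; the successor avoids
   division by 0 when [I] is empty. *)
pose e' := e / (#|I|.+1)%:R.
have e'0 : 0 < e' by rewrite divr_gt0.
have /choice [k kP] j : exists u, U u /\ sup [set g j u | u in U] - e' < g j u.
  by have [_ [u Uu <-] ?] := sup_adherent e'0 (hS j); exists u.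
apply: (@le_trans _ _ (\sum_j (g j (k j) + e'))).
  by apply: ler_sum => j _; have [_] := kP j; lra.
rewrite big_split /= sumr_const lerD //; first by apply: sumv => j; have [] := kP j.
rewrite -mulr_natr /e' -mulrA ler_piMr ?(ltW e0) //.
by rewrite mulrC ler_pdivrMr // mul1r ler_nat.
Qed.

(** * Finitely supported probability measures *)

Lemma probability_of_measure (R : realType) (d : measure_display) (T : measurableType d)
    (x : T) (m : {measure set T -> \bar R}) :
  m setT = 1%E -> exists P : probability T R, (P : set T -> \bar R) = m.
Proof.
(* The Dirac measure is the fallback of [mnormalize] for mass 0 or infinity; with mass 1,
   normalising returns [m] itself. *)
move=> m1; exists (mnormalize m (\d_x : probability T R)).
apply/funext => A; rewrite /= /mnormalize m1 /= onee_eq0 /=.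
by rewrite invr1 mule1.
Qed.

Lemma discrete_probability (R : realType) (d : measure_display) (T : measurableType d)
    (I : finType) (w : I -> R) (x : I -> T) :
  (forall i, 0 <= w i) -> \sum_i w i = 1 ->
  exists P : probability T R,
    (forall A, P A = \sum_i ((w i)%:E * \d_(x i) A))%E /\
    (forall f : T -> \bar R, measurable_fun setT f -> (forall t, 0 <= f t)%E ->
       \int[P]_t f t = \sum_i (w i)%:E * f (x i))%E.
Proof.
move=> w0 w1.
(* [msum] adds a sequence indexed by naturals, so [I] is enumerated and the sequence continued by
   the zero measure. *)
pose m_ (k : nat) : {measure set T -> \bar R} :=
  if insub k is Some i
  then mscale (NngNum (w0 (enum_val (i : 'I_#|I|)))) (\d_(x (enum_val i)))
  else mzero.
pose m : {measure set T -> \bar R} := msum m_ #|I|.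
have m_E (i : 'I_#|I|) :
    m_ i = mscale (NngNum (w0 (enum_val i))) (\d_(x (enum_val i))) by rewrite /m_ valK.
have mE A : (m A = \sum_i ((w i)%:E * \d_(x i) A))%E.
  rewrite /m /= /msum [RHS](reindex _ (onW_bij _ (@enum_val_bij I))) /=.
  by apply: eq_bigr => i _; rewrite m_E.
have m1 : m setT = 1%E.
  rewrite mE -[RHS]/(1%:E) -w1 -sumEFin; apply: eq_bigr => i _.
  by rewrite diracT mule1.
have [i0 _|noI] := pickP (fun _ : I => true); last first.
  by move: w1; rewrite big1 => [/eqP|i]; [rewrite eq_sym oner_eq0 | have := noI i].
have [P PE] := probability_of_measure (x i0) m1.
exists P; split; first by move=> A; rewrite PE mE.
move=> f mf f0.
transitivity (\int[m]_t f t)%E; first by apply: eq_measure_integral => A _ _; exact: (congr1 (@^~ A) PE).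
rewrite ge0_integral_measure_sum //.
rewrite [RHS](reindex _ (onW_bij _ (@enum_val_bij I))) /=.
apply: eq_bigr => i _; rewrite m_E ge0_integral_mscale // integral_dirac //.
by rewrite diracT mul1e.
Qed.

Lemma full_prob_ae (R : realType) (d : measure_display) (T : measurableType d)
    (P : probability T R) (A : set T) :
  measurable A -> P A = 1%E -> \forall x \ae P, A x.
Proof.
move=> mA PA; exists (~` A); split => //; first exact: measurableC.
by rewrite probability_setC // PA subee.
Qed.

(** * Couplings with the empirical distribution, and both directions of duality *)

Section Wasserstein.
Variables (R : realType) (n N : nat) (p : R) (uh : 'I_N -> 'cV[R]_n).
Hypothesis p0 : 0 < p.
Hypothesis N0 : (0 < N)%N.

Let N0r : (N%:R : R) != 0. Proof. by rewrite pnatr_eq0 -lt0n. Qed.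

Definition transport_cost (Pi : probability (Rn R n * Rn R n)%type R) : \bar R :=
  (\int[Pi]_z (pcost p ((z.1 : 'cV[R]_n) - z.2))%:E)%E.

Lemma wass_le (mu1 mu2 : set (Rn R n) -> \bar R) (eps : R) : 0 <= eps ->
  (wass p mu1 mu2 <= eps%:E)%E <->
  (ereal_inf [set transport_cost Pi | Pi in coupling mu1 mu2] <= (eps `^ p)%:E)%E.
Proof.
move=> eps0.
have -> : [set transport_cost Pi | Pi in coupling mu1 mu2] =
  [set (\int[Pi]_z ((lpnorm p ((z.1 : 'cV[R]_n) - z.2)) `^ p)%:E)%E
     | Pi in coupling mu1 mu2].
  apply: eq_imagel => Pi _; apply: eq_integral => z _.
  by rewrite lpnormX // gt_eqF.
rewrite /wass; set I := ereal_inf _.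
have I0 : (0 <= I)%E.
  apply: le_ereal_inf_tmp => _ [Pi _ <-]; apply: integral_ge0 => z _.
  by rewrite lee_fin powR_ge0.
have mono (r : R) (x y : \bar R) : 0 < r -> (0 <= x)%E -> (0 <= y)%E -> (x <= y)%E ->
    (x `^ r <= y `^ r)%E.
  by move=> r0 x0 y0; apply: gt0_ler_poweR; rewrite ?ltW // in_itv /= ?x0 ?y0 leey.
have root (x : \bar R) : (0 <= x)%E -> ((x `^ p^-1) `^ p)%E = x.
  by move=> x0; rewrite -poweRrM mulVf ?gt_eqF // poweRe1.
have root' (x : \bar R) : (0 <= x)%E -> ((x `^ p) `^ p^-1)%E = x.
  by move=> x0; rewrite -poweRrM mulfV ?gt_eqF // poweRe1.
split => h.
  by rewrite -poweR_EFin -[leLHS]root //; apply: mono; rewrite ?poweR_ge0 ?lee_fin.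
rewrite -[leRHS]root' ?lee_fin // poweR_EFin.
by apply: mono; rewrite ?invr_gt0 ?lee_fin ?powR_ge0.
Qed.

Lemma empiricalE (A : set (Rn R n)) :
  empirical uh A = (N%:R^-1 * \sum_(j < N) (uh j \in A)%:R)%:E.
Proof.
rewrite /empirical EFinM; congr (_ * _)%E; rewrite -sumEFin.
by apply: eq_bigr => j _; rewrite diracE.
Qed.

Lemma range_measurable : measurable (range uh : set (Rn R n)).
Proof.
have -> : range uh = \big[setU/set0]_(j < N) [set uh j].
  apply/seteqP; split => x.
    by move=> [j _ <-]; rewrite (bigD1 j) //=; left.
  by elim/big_ind: _ => [[]|A B IA IB [/IA|/IB]|j _ ->] //; exists j.
by apply: bigsetU_measurable => j _; exact: set1_Rn_measurable.
Qed.

Lemma empirical_range : empirical uh (range uh) = 1%E.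
Proof.
rewrite empiricalE (eq_bigr (fun=> 1)).
  by rewrite sumr_const card_ord mulVf.
by move=> j _; rewrite mem_set //; exists j.
Qed.

(* Data points may coincide, so each sample shares its atom with [mult]
   samples and carries only the fraction [1 / mult] of its weight. *)
Let mult (j : 'I_N) : R := \sum_(k < N) (uh k \in [set uh j])%:R.

Let mult_gt0 j : 0 < mult j.
Proof.
rewrite /mult (bigD1 j) //= mem_set // ltr_pwDl //.
by apply: sumr_ge0 => k _; rewrite ler0n.
Qed.

(** Almost surely under [Pi] the first component lies in [U] and the second is a data point, so the
    hypothesis on [f] applies pointwise and can be integrated. *)
Lemma coupling_integral_le (f : 'cV[R]_n -> R) (U : set 'cV[R]_n)
    (Q : probability (Rn R n) R) (Pi : probability (Rn R n * Rn R n)%type R)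
    (rho : R) (beta : 'I_N -> R) :
  continuous f -> (forall u, 0 <= f u) -> closed U -> (forall j, U (uh j)) ->
  Q U = 1%E -> coupling Q (empirical uh) Pi -> 0 <= rho ->
  (forall j u, U u -> f u <= beta j + rho * pcost p (u - uh j)) ->
  (\int[Q]_u (f u)%:E <=
     rho%:E * transport_cost Pi + (N%:R^-1 * \sum_(j < N) beta j)%:E)%E.
Proof.
move=> fc f0 cU Uuh QU PiP rho0 fle.
(* Taking u = [uh j], where the transport cost vanishes. This sign makes all integrands nonnegative,
   so no integrability has to be checked. *)
have beta0 j : 0 <= beta j.
  have := fle j _ (Uuh j); rewrite subrr pcost0 ?gt_eqF // mulr0 addr0.
  exact: le_trans.
have mf : measurable_fun [set: Rn R n] (fun u => (f u)%:E).
  by apply/measurable_EFinP; exact: cont_Rn_measurable.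
have mfst : measurable_fun [set: (Rn R n * Rn R n)%type] (@fst (Rn R n) (Rn R n)).
  exact: measurable_fst.
have -> : (\int[Q]_u (f u)%:E = \int[Pi]_z (f z.1)%:E)%E.
  transitivity (\int[pushforward Pi fst]_u (f u)%:E)%E.
    apply: eq_measure_integral => A mA _.
    apply: etrans (esym (PiP A mA).1) _; congr (Pi _).
    by apply/seteqP; split => [z []|z] //=.
  rewrite ge0_integral_pushforward //.
  by move=> u _; rewrite lee_fin.
(* The atom at [uh j] has mass [mult j / N], so [h j] integrates to [beta j / N]; at a data point
   the sum of the [h j] averages [beta] over the samples located there. *)
pose h (j : 'I_N) (z : (Rn R n * Rn R n)%type) : \bar R :=
  ((beta j / mult j)%:E * (\1_([set: Rn R n] `*` [set uh j]) z)%:E)%E.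
have mset j : measurable ([set: Rn R n] `*` ([set uh j] : set (Rn R n))).
  by apply: measurableX => //; exact: set1_Rn_measurable.
have bm0 j : 0 <= beta j / mult j by rewrite divr_ge0 // ltW.
have mh j : measurable_fun setT (h j).
  by apply: measurable_funeM; apply/measurable_EFinP; exact: measurable_indic.
have h0 j z : (0 <= h j z)%E by rewrite mule_ge0 // lee_fin.
have mc : measurable_fun [set: (Rn R n * Rn R n)%type]
    (fun z => (pcost p ((z.1 : 'cV[R]_n) - z.2))%:E).
  by apply/measurable_EFinP; exact: pcost_measurable.
have c0 (z : (Rn R n * Rn R n)%type) : (0 <= (pcost p ((z.1 : 'cV[R]_n) - z.2))%:E)%E.
  by rewrite lee_fin pcost_ge0.
have -> : (N%:R^-1 * \sum_(j < N) beta j)%:E = (\int[Pi]_z \sum_(j < N) h j z)%E.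
  rewrite ge0_integral_sum // mulr_sumr -sumEFin; apply: eq_bigr => j _.
  rewrite ge0_integralZl_EFin //; last first.
    by apply/measurable_EFinP; exact: measurable_indic.
  rewrite integral_indic // setIT.
  apply: (@etrans _ _ ((beta j / mult j)%:E * empirical uh [set uh j])%E).
    rewrite empiricalE -/(mult j) -EFinM.
    by congr _%:E; field; rewrite N0r gt_eqF.
  by congr (_ * _)%E; exact: esym (PiP [set uh j] (set1_Rn_measurable (uh j))).2.
rewrite /transport_cost -ge0_integralZl_EFin //.
rewrite -ge0_integralD //; [|by move=> z _; rewrite mule_ge0|
  exact: measurable_funeM|by move=> z _; exact: sume_ge0|exact: emeasurable_sum].
apply: ae_ge0_le_integral => //.
- by move=> z _; rewrite lee_fin.
- exact: (measurableT_comp mf mfst).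
- by move=> z _; rewrite adde_ge0 ?mule_ge0 // sume_ge0.
- by apply: emeasurable_funD; [exact: measurable_funeM | exact: emeasurable_sum].
have ae1 : \forall z \ae Pi, (U `*` setT) z.
  apply: full_prob_ae; last exact: etrans (PiP U (closed_Rn_measurable cU)).1 QU.
  by apply: measurableX => //; exact: closed_Rn_measurable.
have ae2 : \forall z \ae Pi, (setT `*` range uh) z.
  apply: full_prob_ae.
    by apply: measurableX => //; exact: range_measurable.
  exact: etrans (PiP (range uh) range_measurable).2 empirical_range.
apply: (@filterS2 _ _ (ae_filter_ringOfSetsType Pi)) ae1 ae2 => -[u v] /= [Uu _] [_ [j _ <-]] _.
have -> : (\sum_(k < N) h k (u, uh j))%E = (\sum_(k < N) beta k / mult k * (uh j == uh k)%:R)%:E.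
  rewrite -sumEFin; apply: eq_bigr => k _.
  rewrite /h -EFinM indicE; congr (_ * _%:R)%:E; congr nat_of_bool.
  apply/idP/idP; first by rewrite inE /= => -[_ ->].
  by move/eqP => E; rewrite inE.
rewrite -EFinM -EFinD lee_fin -lerBlDl; set x := f u - _.
(* Spreading [x] evenly over the samples sharing the atom reduces the claim to one inequality per
   sample. *)
have -> : x = \sum_(k < N) x / mult k * (uh j == uh k)%:R.
  have multE k : uh j == uh k -> mult k = mult j by rewrite /mult => /eqP ->.
  transitivity (x / mult j * \sum_(k < N) (uh j == uh k)%:R).
    have -> : \sum_(k < N) (uh j == uh k)%:R = mult j.
      apply: eq_bigr => k _; congr (_%:R); congr nat_of_bool.
      by apply/eqP/idP => [->|]; rewrite inE.
    by rewrite divfK // gt_eqF.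
  rewrite mulr_sumr; apply: eq_bigr => k _.
  by case: eqP (multE k) => [_ ->|_ _] //; rewrite !mulr0.
apply: ler_sum => k _; case: eqP => [E|_]; last by rewrite !mulr0.
rewrite !mulr1 ler_wpM2r ?invr_ge0 ?(ltW (mult_gt0 _)) //.
by rewrite /x lerBlDr; have := fle k u Uu; rewrite -E.
Qed.

Lemma wass_dual_le (f : 'cV[R]_n -> R) (U : set 'cV[R]_n) (eps rho : R)
    (beta : 'I_N -> R) (Q : probability (Rn R n) R) :
  continuous f -> (forall u, 0 <= f u) -> closed U -> (forall j, U (uh j)) ->
  0 <= eps -> ambiguity p eps U uh Q -> 0 <= rho ->
  (forall j u, U u -> f u <= beta j + rho * pcost p (u - uh j)) ->
  (\int[Q]_u (f u)%:E <= (eps `^ p * rho + N%:R^-1 * \sum_(j < N) beta j)%:E)%E.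
Proof.
move=> fc f0 cU Uuh eps0 [QU] /(wass_le _ _ eps0) infle rho0 fle.
apply/lee_addgt0Pr => e e0.
(* A near-optimal coupling is used, with an excess cost that remains below [e] after multiplication
   by [rho]; adding 1 covers [rho = 0]. *)
have e'0 : 0 < e / (rho + 1) by rewrite divr_gt0 // ltr_wpDl.
have : (ereal_inf [set transport_cost Pi | Pi in coupling Q (empirical uh)] <
  (eps `^ p + e / (rho + 1))%:E)%E.
  by apply: le_lt_trans infle _; rewrite lte_fin ltrDl.
move=> /ereal_inf_lt [_ [Pi PiP <-] /ltW Pile].
apply: le_trans (coupling_integral_le fc f0 cU Uuh QU PiP rho0 fle) _.
apply: (@le_trans _ _ (rho%:E * (eps `^ p + e / (rho + 1))%:E +
   (N%:R^-1 * \sum_(j < N) beta j)%:E)%E).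
  by rewrite leeD2r // lee_wpmul2l ?lee_fin.
rewrite -EFinM -!EFinD lee_fin mulrDr.
have : rho * (e / (rho + 1)) <= e.
  by rewrite mulrCA ler_piMr ?(ltW e0) // ler_pdivrMr ?ltr_wpDl //; lra.
by rewrite [rho * (eps `^ p)]mulrC; lra.
Qed.

Definition mean_cost (k : 'I_N -> 'cV[R]_n) : R :=
  N%:R^-1 * \sum_(j < N) pcost p (k j - uh j).

Definition mean_val (f : 'cV[R]_n -> R) (k : 'I_N -> 'cV[R]_n) : R :=
  N%:R^-1 * \sum_(j < N) f (k j).

(** Sample j sends the fraction [t] of its mass to [k j] and the rest to [l j]. This transport plan
    is a coupling whose cost is the mixed mean cost. *)
Lemma mixture_ambiguity (f : 'cV[R]_n -> R) (U : set 'cV[R]_n) (eps t : R)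
    (k l : 'I_N -> 'cV[R]_n) :
  continuous f -> (forall u, 0 <= f u) -> closed U ->
  (forall j, U (k j)) -> (forall j, U (l j)) -> 0 <= eps -> 0 <= t <= 1 ->
  t * mean_cost k + (1 - t) * mean_cost l <= eps `^ p ->
  exists2 Q : probability (Rn R n) R, ambiguity p eps U uh Q &
    (\int[Q]_u (f u)%:E = (t * mean_val f k + (1 - t) * mean_val f l)%:E)%E.
Proof.
move=> fc f0 cU Uk Ul eps0 /andP[t0 t1] cost_le.
pose w (i : bool * 'I_N) : R := N%:R^-1 * (if i.1 then t else 1 - t).
pose x (i : bool * 'I_N) : Rn R n := if i.1 then k i.2 else l i.2.
have w0 i : 0 <= w i.
  by rewrite /w mulr_ge0 ?invr_ge0 ?ler0n //; case: i.1; rewrite ?subr_ge0.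
(* One identity evaluates the total mass, the expectation of [f], the transport cost and the second
   marginal, according to the choice of [g]. *)
have wsum (g : 'cV[R]_n -> 'I_N -> R) : \sum_i w i * g (x i) i.2 =
    t * (N%:R^-1 * \sum_j g (k j) j) + (1 - t) * (N%:R^-1 * \sum_j g (l j) j).
  rewrite -(pair_bigA _ (fun b j => w (b, j) * g (x (b, j)) j)) big_bool /= /w /x /=.
  by rewrite -!mulr_sumr; ring.
have w1 : \sum_i w i = 1.
  have := wsum (fun _ _ => 1); under eq_bigr do rewrite mulr1.
  by move=> ->; rewrite sumr_const card_ord mulVf //; ring.
have [Q [QE Qint]] := discrete_probability x w0 w1.
pose z (i : bool * 'I_N) : (Rn R n * Rn R n)%type := (x i, uh i.2).
have [Pi [PiE Piint]] := discrete_probability z w0 w1.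
have Ux i : U (x i) by rewrite /x; case: i.1.
exists Q; last first.
  rewrite Qint; last by move=> u; rewrite lee_fin.
    under eq_bigr do rewrite -EFinM.
    by rewrite sumEFin (wsum (fun u _ => f u)).
  by apply/measurable_EFinP; exact: cont_Rn_measurable.
split.
  rewrite QE -[RHS]/(1%:E) -w1 -sumEFin; apply: eq_bigr => i _.
  by rewrite diracE mem_set // mule1.
apply/(wass_le _ _ eps0); apply: ge_ereal_inf.
exists (transport_cost Pi); last first.
  rewrite /transport_cost Piint.
  - under eq_bigr do rewrite -EFinM.
    by rewrite sumEFin (wsum (fun u j => pcost p (u - uh j))) lee_fin.
  - by apply/measurable_EFinP; exact: pcost_measurable.
  - by move=> ?; rewrite lee_fin pcost_ge0.
exists Pi => // A mA; split.
  rewrite PiE QE; apply: eq_bigr => i _; rewrite !diracE /z; congr (_ * _%:R%:E)%E.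
  by congr nat_of_bool; apply/idP/idP; rewrite !inE => // -[].
rewrite PiE empiricalE.
transitivity (\sum_i w i * (uh i.2 \in A)%:R)%:E.
  rewrite -sumEFin; apply: eq_bigr => i _; rewrite !diracE /z EFinM; congr (_ * _%:R%:E)%E.
  by congr nat_of_bool; apply/idP/idP; rewrite !inE => // -[].
by rewrite (wsum (fun _ j => (uh j \in A)%:R)); congr _%:E; ring.
Qed.

(** Strong duality with attained multipliers: [supporting_slope], applied to the pairs (mean cost,
    mean value), gives [rho], and [separable_bound] then distributes the averaged inequality over
    the samples as [beta]. The data points themselves cost 0 < eps^p, which supplies the strict
    point. *)
Lemma wass_dual_ge (f : 'cV[R]_n -> R) (U : set 'cV[R]_n) (eps : R) :
  continuous f -> (forall u, 0 <= f u) -> compact U ->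
  (forall j, U (uh j)) -> 0 < eps ->
  exists rho beta, [/\ 0 <= rho,
    forall j u, U u -> f u <= beta j + rho * pcost p (u - uh j) &
    ((eps `^ p * rho + N%:R^-1 * \sum_(j < N) beta j)%:E <=
      ereal_sup [set \int[Q]_u (f u)%:E | Q in ambiguity p eps U uh])%E].
Proof.
move=> fc f0 cptU Uuh eps0; have cU : closed U.
  by apply: compact_closed => //; exact: norm_hausdorff.
have U0 : U !=set0 by exists (uh (Ordinal N0)).
have [M fM] : exists M, forall u, U u -> f u <= M.
  have [|m _ fm] := compact_EVT_max U0 cptU (f := f).
    exact: continuous_subspaceT.
  by exists (f m) => u Uu; apply: fm; rewrite inE.
set V := ereal_sup _.
have delta0 : 0 < eps `^ p by exact: powR_gt0.
have atoms k l t : (forall j, U (k j)) -> (forall j, U (l j)) -> 0 <= t <= 1 ->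
    t * mean_cost k + (1 - t) * mean_cost l <= eps `^ p ->
    ((t * mean_val f k + (1 - t) * mean_val f l)%:E <= V)%E.
  move=> Uk Ul t01 cle.
  have [Q Qamb <-] := mixture_ambiguity fc f0 cU Uk Ul (ltW eps0) t01 cle.
  by apply: ereal_sup_ubound; exists Q.
have cost_uh : mean_cost uh = 0.
  by rewrite /mean_cost big1 ?mulr0 // => j _; rewrite subrr pcost0 // gt_eqF.
(* Bounded below by the value at the data points, and above by weak duality with [rho = 0] and
   [beta] constantly [M]. *)
have Vfin : V \is a fin_num.
  rewrite fin_numE; apply/andP; split.
    have := atoms uh uh 1 Uuh Uuh; rewrite lexx ler01 cost_uh => /(_ isT).
    by rewrite !mulr0 addr0 => /(_ (ltW delta0)) h; apply: contraTneq h => ->.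
  have : (V <= (eps `^ p * 0 + N%:R^-1 * \sum_(j < N) M)%:E)%E.
    apply: ge_ereal_sup => _ [Q Qamb <-].
    apply: wass_dual_le Qamb _ _ => //; first exact: ltW.
    by move=> j u Uu; rewrite mul0r addr0 fM.
  by apply: contraTneq => ->.
pose v := fine V; have VE : V = v%:E by rewrite fineK.
pose P : set ('I_N -> 'cV[R]_n) := [set k | forall j, U (k j)].
have [|k l t Pk Pl t01 cle|rho [rho0 rhoP]] :=
  @supporting_slope _ _ P mean_cost (mean_val f) (eps `^ p) v.
- by exists uh => //; rewrite cost_uh.
- by rewrite -lee_fin -VE; exact: atoms.
pose g (j : 'I_N) u := f u - rho * pcost p (u - uh j).
have [|k Uk|beta [gle bsum]] :=
  @separable_bound _ _ _ U g (N%:R * (v - rho * eps `^ p)) U0.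
- move=> j; exists M => u Uu; rewrite lerBlDr ler_wpDr ?fM //.
  by rewrite mulr_ge0 // pcost_ge0.
- have := rhoP k Uk; rewrite /g sumrB -mulr_sumr /mean_cost /mean_val.
  have Np : 0 < N%:R :> R by rewrite ltr0n.
  rewrite -(ler_pM2l Np) mulrA mulfV // mul1r.
  have alg (x y z s e : R) :
    x * (y + z * (x^-1 * s - e)) = x * (y - z * e) + z * (x * x^-1) * s by ring.
  rewrite alg.
  by rewrite mulfV // mulr1 lerBlDr.
exists rho, beta; split => //.
  by move=> j u Uu; have := gle j u Uu; rewrite /g lerBlDr.
rewrite VE lee_fin.
have Np : 0 < N%:R :> R by rewrite ltr0n.
rewrite -lerBrDl ler_pdivrMl //; apply: le_trans bsum _.
by rewrite [eps `^ p * rho]mulrC.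
Qed.

End Wasserstein.

(** * Copositivity over the perspective cones *)

Lemma dotDl (R : realType) (n : nat) (x y z : 'cV[R]_n) : dot (x + y) z = dot x z + dot y z.
Proof. by rewrite /dot -big_split; apply: eq_bigr => i _; rewrite mxE mulrDl. Qed.

Lemma dotC (R : realType) (n : nat) (x y : 'cV[R]_n) : dot x y = dot y x.
Proof. by apply: eq_bigr => i _; rewrite mulrC. Qed.

Lemma dotZl (R : realType) (n : nat) (a : R) (x y : 'cV[R]_n) : dot (a *: x) y = a * dot x y.
Proof. by rewrite /dot mulr_sumr; apply: eq_bigr => i _; rewrite mxE mulrA. Qed.

Lemma dotBl (R : realType) (n : nat) (x y z : 'cV[R]_n) : dot (x - y) z = dot x z - dot y z.
Proof. by rewrite dotDl -scaleN1r dotZl mulN1r. Qed.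

Lemma dotDr (R : realType) (n : nat) (x y z : 'cV[R]_n) : dot z (x + y) = dot z x + dot z y.
Proof. by rewrite dotC dotDl dotC [dot y z]dotC. Qed.

Lemma dotZr (R : realType) (n : nat) (a : R) (x y : 'cV[R]_n) : dot x (a *: y) = a * dot x y.
Proof. by rewrite dotC dotZl dotC. Qed.

Lemma dotBr (R : realType) (n : nat) (x y z : 'cV[R]_n) : dot z (x - y) = dot z x - dot z y.
Proof. by rewrite dotC dotBl dotC [dot y z]dotC. Qed.

Lemma mul_tr_dot (R : realType) (n : nat) (x y : 'cV[R]_n) : (x^T *m y) 0 0 = dot x y.
Proof. by rewrite mxE; apply: eq_bigr => i _; rewrite mxE. Qed.

Definition qform (R : realType) (k : nat) (M : 'M[R]_k) (x : 'cV[R]_k) : R :=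
  (x^T *m M *m x) 0 0.

Lemma qformB (R : realType) (k : nat) (A B : 'M[R]_k) (x : 'cV[R]_k) :
  qform (A - B) x = qform A x - qform B x.
Proof. by rewrite /qform mulmxBr mulmxBl !mxE. Qed.

Lemma qform_block (R : realType) (k l : nat) (A : 'M[R]_k) (B : 'M[R]_(k, l))
    (C : 'M[R]_(l, k)) (D : 'M[R]_l) (x : 'cV[R]_k) (z : 'cV[R]_l) :
  qform (block_mx A B C D) (col_mx x z) =
  qform A x + dot x (B *m z) + dot z (C *m x) + qform D z.
Proof.
rewrite /qform tr_col_mx mul_row_block mul_row_col !mulmxDl -!mulmxA.
by rewrite !mxE -!mul_tr_dot !mxE -!addrA; congr (_ + _); rewrite addrCA.
Qed.

Lemma qform_scalar1 (R : realType) (A : 'M[R]_1) (t : R) : qform A t%:M = t ^+ 2 * A 0 0.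
Proof.
by rewrite /qform tr_scalar_mx mul_scalar_mx mul_mx_scalar !mxE mulrA expr2.
Qed.

Lemma qform0 (R : realType) (k : nat) (x : 'cV[R]_k) : qform 0 x = 0.
Proof. by rewrite /qform mulmx0 mul0mx mxE. Qed.

Lemma dot_scalar1 (R : realType) (t : R) (x : 'cV[R]_1) : dot t%:M x = t * x 0 0.
Proof. by rewrite /dot big_ord1 mxE mulr1n. Qed.

Lemma dot_col (R : realType) (k l : nat) (x x' : 'cV[R]_k) (y y' : 'cV[R]_l) :
  dot (col_mx x y) (col_mx x' y') = dot x x' + dot y y'.
Proof. by rewrite -!mul_tr_dot tr_col_mx mul_row_col mxE. Qed.

Lemma qform_e1 (R : realType) (k : nat) (b t : R) (z : 'cV[R]_k) :
  qform (b *: (e1 R k *m (e1 R k)^T)) (col_mx t%:M z) = t ^+ 2 * b.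
Proof.
have e1E : e1 R k = col_mx 1%:M 0.
  apply/matrixP => i j; rewrite !mxE (ord1 j); case: splitP => h hi.
    rewrite (ord1 h) !mxE eqxx andbT; congr (_%:R); congr nat_of_bool.
    by apply/eqP/val_inj; rewrite /= hi (ord1 h).
  by rewrite mxE andbT; case: eqP => // ih; move: hi; rewrite ih /=; lia.
rewrite e1E tr_col_mx mul_col_row !trmx0 !mul0mx !mulmx0 tr_scalar_mx mulmx1.
rewrite scale_block_mx !scaler0 qform_block !mul0mx qform0 qform_scalar1.
have dot0 m (x : 'cV[R]_m) : dot x 0 = 0.
  by rewrite /dot big1 // => i _; rewrite mxE mulr0.
by rewrite !dot0 !addr0 !mxE mulr1.
Qed.

Lemma tr_e1_block (R : realType) (k : nat) (b : R) :
  (b *: (e1 R k *m (e1 R k)^T))^T = b *: (e1 R k *m (e1 R k)^T).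
Proof. by rewrite linearZ /= trmx_mul trmxK. Qed.

Lemma qform_H1 (R : realType) (n : nat) (uhj s up um y : 'cV[R]_n) (rho t : R) :
  qform (H1 uhj rho s) (col_mx t%:M (col_mx (col_mx up um) y)) =
  - (rho * t * \sum_(i < n) (up i 0 + um i 0)) + t * dot (uhj - s) y + dot (up - um) y.
Proof.
have sumE (x : 'cV[R]_n) : dot (const_mx 1) x = \sum_i x i 0.
  by apply: eq_bigr => i _; rewrite mxE mul1r.
rewrite /H1 qform_block qform_scalar1 mxE mulr0 add0r.
rewrite qform_block !qform0 addr0 add0r.
have addE (A B : 'M[R]_1) : (A + B) 0 0 = A 0 0 + B 0 0 by rewrite mxE.
have scaleE (a : R) (A : 'M[R]_1) : (a *: A) 0 0 = a * A 0 0 by rewrite mxE.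
rewrite !mul_row_col !mul_col_mx !mul_mx_scalar.
rewrite -!scalemxAl !mul1mx.
rewrite dot_scalar1 !dot_col !(addE, scaleE) !mul_tr_dot !dotDr !dotZr !sumE.
rewrite [dot _ (const_mx 1)]dotC [dot um (const_mx 1)]dotC !sumE big_split /=.
rewrite !dotBl !dotBr ![dot y _]dotC; by field.
Qed.

Lemma qform_H2 (R : realType) (n : nat) (uhj s u y : 'cV[R]_n) (rho t : R) :
  qform (H2 uhj rho s) (col_mx t%:M (col_mx u y)) =
  - rho * dot (u - t *: uhj) (u - t *: uhj) - t * dot s y + dot u y.
Proof.
have addE (A B : 'M[R]_1) : (A + B) 0 0 = A 0 0 + B 0 0 by rewrite mxE.
have scaleE (a : R) (A : 'M[R]_1) : (a *: A) 0 0 = a * A 0 0 by rewrite mxE.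
rewrite /H2 qform_block qform_scalar1 mxE mulr1n.
rewrite qform_block !qform0 addr0.
have -> : qform (- rho *: 1%:M) u = - rho * dot u u.
  by rewrite /qform -scalemxAr -scalemxAl mulmx1 scaleE mul_tr_dot.
have -> : \sum_(i < n) uhj i 0 ^+ 2 = dot uhj uhj by [].
rewrite !mul_row_col !mul_col_mx !mul_mx_scalar.
rewrite -!scalemxAl !mul1mx.
rewrite dot_scalar1 !dot_col !(addE, scaleE) !mul_tr_dot !dotZr.
rewrite !dotBl !dotBr !dotZl !dotZr ![dot y _]dotC [dot u uhj]dotC; by field.
Qed.

Lemma tr_H1 (R : realType) (n : nat) (uhj s : 'cV[R]_n) (rho : R) :
  (H1 uhj rho s)^T = H1 uhj rho s.
Proof.
rewrite /H1 2!tr_block_mx !(tr_row_mx, tr_col_mx).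
by rewrite !trmx0 !linearZ /= !trmxK tr_scalar_mx.
Qed.

Lemma tr_H2 (R : realType) (n : nat) (uhj s : 'cV[R]_n) (rho : R) :
  (H2 uhj rho s)^T = H2 uhj rho s.
Proof.
rewrite /H2 2!tr_block_mx tr_row_mx tr_col_mx.
by rewrite !trmx0 !linearZ /= !trmxK !tr_scalar_mx.
Qed.

(** A quadratic form is continuous, so the set where it is nonnegative is closed and contains the
    closure of [G] once it contains [G]. *)
Lemma COP_closure (R : realType) (k : nat) (G : set 'cV[R]_k) (M : 'M[R]_k) :
  M^T = M -> (COP (closure G) M <-> forall x, G x -> 0 <= qform M x).
Proof.
move=> Msym; split => [[_ MG] x Gx|MG]; first by apply: MG; exact: subset_closure.
split => // x Gx.
have qc : continuous (qform M).
  have -> : qform M = fun x => \sum_i (\sum_j x j 0 * M j i) * x i 0.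
    apply/funext => z; rewrite /qform mxE; apply: eq_bigr => i _; congr (_ * _).
    by rewrite mxE; apply: eq_bigr => j _; rewrite mxE.
  apply: cont_sum => i; apply: cont_mul; last exact: coord_continuous.
  apply: cont_sum => j; apply: cont_mul; [exact: coord_continuous | exact: cont_const].
have cl : closed (qform M @^-1` [set r | 0 <= r]).
  by apply: closed_comp => //; exact: closed_ge.
have := closureS (B := qform M @^-1` [set r | 0 <= r]) MG Gx.
by rewrite -(closure_id _).1.
Qed.

Lemma pcost1 (R : realType) (n : nat) (x : 'cV[R]_n) : pcost 1 x = \sum_(i < n) `|x i 0|.
Proof. by apply: eq_bigr => i _; rewrite powRr1. Qed.

Lemma pcost2 (R : realType) (n : nat) (x : 'cV[R]_n) : pcost 2 x = dot x x.
Proof.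
by apply: eq_bigr => i _; rewrite powR_mulrn // real_normK ?num_real // expr2.
Qed.

Section Copositive.
Variables (R : realType) (n : nat) (c d : 'cV[R]_n) (C : R) (U : set 'cV[R]_n).
Hypothesis c0 : forall i, 0 <= c i 0.
Hypothesis d0 : forall i, 0 <= d i 0.
Hypothesis C0 : 0 <= C.
Hypothesis cd : forall i j : 'I_n, j = i.+1 :> nat -> d j 0 - d i 0 <= c j 0.

(** Forwards, the form is evaluated at t = 1, at the positive and negative parts of [u - uhj] and at
    an optimal dual [y]. Backwards, it equals t^2 times a slack, which weak duality bounds below. *)
Lemma COP_K1 (uhj s : 'cV[R]_n) (rho b : R) : 0 <= rho ->
  COP (K1 c d C U uhj) (b *: (e1 R (n + n + n) *m (e1 R (n + n + n))^T) - H1 uhj rho s)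
  <-> forall u, U u -> fopt c d C s u <= b + rho * pcost 1 (u - uhj).
Proof.
move=> rho0.
rewrite /K1 COP_closure; last first.
  by rewrite linearB /= tr_e1_block tr_H1.
split => [qpos u Uu | fle x].
  have [y [Yy <-]] := lp_strong s u c0 d0 C0 cd.
  pose up : 'cV[R]_n := \col_i Num.max 0 (u i 0 - uhj i 0).
  pose um : 'cV[R]_n := \col_i Num.max 0 (uhj i 0 - u i 0).
  have pm i : up i 0 - um i 0 = u i 0 - uhj i 0 /\ up i 0 + um i 0 = `|u i 0 - uhj i 0|.
    rewrite !mxE; case: (leP (uhj i 0) (u i 0)) => h.
      by rewrite ger0_norm ?subr_ge0 // max_r ?subr_ge0 // max_l ?subr_le0 //; split; ring.
    have h' := ltW h.
    by rewrite ler0_norm ?subr_le0 // max_l ?subr_le0 // max_r ?subr_ge0 //; split; ring.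
  have upmE : up - um = u - uhj.
    by apply/colP => i; rewrite mxE [(- um) i 0]mxE (pm i).1 !mxE.
  have := qpos (col_mx 1%:M (col_mx (col_mx up um) y)).
  rewrite qformB qform_e1 qform_H1 upmE expr1n !mul1r mulr1 pcost1.
  rewrite (eq_bigr (fun i => `|(u - uhj) i 0|)); last first.
    by move=> i _; rewrite (pm i).2 !mxE.
  rewrite !dotBl; set S := \sum_(i < n) _ => h.
  suff : 0 <= b - (- (rho * S) + (dot uhj y - dot s y) + (dot u y - dot uhj y)) by lra.
  apply: h; exists 1, up, um, y; do 2!split => //.
  rewrite invr1 !scale1r; split; last split; last split => //.
  - by move=> i; rewrite mxE le_max lexx.
  - by move=> i; rewrite mxE le_max lexx.
  - by rewrite upmE subrK.
move=> [t [up [um [y [-> [t0 [up0 [um0 [Uu Yy]]]]]]]]].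
move: up0 um0 Uu Yy.
set up' := _ *: up; set um' := _ *: um; set y' := _ *: y => up0 um0 Uu Yy.
have unscale (z : 'cV[R]_n) : z = t *: (t^-1 *: z) by rewrite scalerA divff ?gt_eqF // scale1r.
rewrite (unscale up) (unscale um) (unscale y) -/up' -/um' -/y'.
clearbody up' um' y'.
rewrite qformB qform_e1 qform_H1.
have := fle _ Uu; have := lp_weak Yy (greedy_feas s (up' - um' + uhj)).
rewrite -/(fopt _ _ _ _ _) addrK pcost1.
(* A point of the cone may have overlapping [up'] and [um']; its linear cost then exceeds the norm,
   which only helps since [rho] is nonnegative. *)
have : \sum_(i < n) `|(up' - um') i 0| <= \sum_(i < n) (up' i 0 + um' i 0).
  apply: ler_sum => i _; rewrite !mxE (le_trans (ler_normB _ _)) //.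
  by have := up0 i; have := um0 i => h1 h2; rewrite !ger0_norm.
move=> /(ler_wpM2l rho0) h1 h2 h3.
have -> : \sum_(i < n) ((t *: up') i 0 + (t *: um') i 0) = t * \sum_(i < n) (up' i 0 + um' i 0).
  by rewrite mulr_sumr; apply: eq_bigr => i _; rewrite [in LHS]mxE [(t *: um') i 0]mxE mulrDr.
rewrite -scalerBr dotZl !dotZr.
move: h1 h2 h3; rewrite !dotBl [dot (_ + uhj) _]dotDl !dotBl => h1 h2 h3.
set S := \sum_(i < n) (up' i 0 + um' i 0) in h1 *.
have -> : t ^+ 2 * b - (- (rho * t * (t * S)) + t * (t * (dot uhj y' - dot s y')) +
    t * (t * (dot up' y' - dot um' y'))) =
  t ^+ 2 * (b + rho * S - (dot up' y' - dot um' y' + dot uhj y' - dot s y')) by ring.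
by rewrite mulr_ge0 ?sqr_ge0 //; lra.
Qed.

(** The squared Euclidean norm is already quadratic, so the homogenised inequality is represented
    exactly, without splitting [u - uhj] into signed parts. *)
Lemma COP_K2 (uhj s : 'cV[R]_n) (rho b : R) :
  COP (K2 c d C U) (b *: (e1 R (n + n) *m (e1 R (n + n))^T) - H2 uhj rho s)
  <-> forall u, U u -> fopt c d C s u <= b + rho * pcost 2 (u - uhj).
Proof.
rewrite /K2 COP_closure; last first.
  by rewrite linearB /= tr_e1_block tr_H2.
split => [qpos u Uu | fle x].
  have [y [Yy <-]] := lp_strong s u c0 d0 C0 cd.
  have := qpos (col_mx 1%:M (col_mx u y)).
  rewrite qformB qform_e1 qform_H2 scale1r pcost2 dotBl => h.
  suff : 0 <= 1 ^+ 2 * b - (- rho * dot (u - uhj) (u - uhj) - 1 * dot s y + dot u y) by lra.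
  apply: h; exists 1, u, y; do 2!split => //.
  by rewrite invr1 !scale1r.
move=> [t [u [y [-> [t0 [Uu Yy]]]]]].
move: Uu Yy; set u' := _ *: u; set y' := _ *: y => Uu Yy.
have unscale (z : 'cV[R]_n) : z = t *: (t^-1 *: z) by rewrite scalerA divff ?gt_eqF // scale1r.
rewrite (unscale u) (unscale y) -/u' -/y' qformB qform_e1 qform_H2.
clearbody u' y'.
have := fle _ Uu; have := lp_weak Yy (greedy_feas s u').
rewrite -/(fopt _ _ _ _ _) pcost2 -scalerBr [dot _ (t *: (u' - uhj))]dotZr !dotZl !dotZr.
rewrite [dot (u' - s) y']dotBl => h1 h2; set S := dot (u' - uhj) _ in h2 *.
have -> : t ^+ 2 * b - (- rho * (t * (t * S)) - t * (t * dot s y') + t * (t * dot u' y')) =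
  t ^+ 2 * (b + rho * S - (dot u' y' - dot s y')) by ring.
by rewrite mulr_ge0 ?sqr_ge0 //; lra.
Qed.
End Copositive.

(** * Reformulation *)

(** Minimising over the auxiliary variables first recovers [h]. Because this inner minimum is
    attained at each [s], the minimisers agree as well as the values. *)
Lemma joint_min (R : realType) (S A B : Type) (F : set S) (h : S -> \bar R)
    (feas : A -> B -> S -> Prop) (obj : A -> B -> \bar R) :
  (forall a b s, feas a b s -> F s) ->
  (forall a b s, feas a b s -> h s <= obj a b)%E ->
  (forall s, F s -> exists a b, feas a b s /\ (obj a b <= h s)%E) ->
  let z := ereal_inf [set h s | s in F] in
  let z' := ereal_inf [set r | exists a b s, feas a b s /\ r = obj a b] in
  z = z' /\
  forall s, (F s /\ h s = z) <-> exists a b, feas a b s /\ obj a b = z'.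
Proof.
move=> feasF weak strong z z'.
have zz : z = z'.
  apply/eqP; rewrite eq_le; apply/andP; split.
    apply: le_ereal_inf_tmp => _ [a [b [s [fs ->]]]]; apply: ge_ereal_inf.
    by exists (h s); [exists s => //; exact: feasF fs | exact: weak].
  apply: le_ereal_inf_tmp => _ [s Fs <-]; apply: ge_ereal_inf.
  have [a [b [fs le]]] := strong s Fs; exists (obj a b) => //.
  by exists a, b, s.
split => // s; split => [[Fs hs]|[a [b [fs objE]]]].
  have [a [b [fs le]]] := strong s Fs; exists a, b; split => //.
  by apply/eqP; rewrite -zz -hs eq_le le (weak _ _ _ fs).
have Fs := feasF _ _ _ fs; split => //; apply/eqP; rewrite eq_le; apply/andP; split.
  by rewrite zz -objE weak.
by apply: ereal_inf_lbound; exists s.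
Qed.

(** Common to both exponents: the conic constraints enter only through their equivalence, in [feas],
    with the inequalities on [fopt]. *)
Lemma wdras_reformulation (R : realType) (n N : nat) (T : R) (c d : 'cV[R]_n) (C : R)
    (U : set 'cV[R]_n) (uh : 'I_N -> 'cV[R]_n) (eps p : R)
    (feas : R -> ('I_N -> R) -> 'cV[R]_n -> Prop) (obj : R -> ('I_N -> R) -> R) :
  0 < p -> (0 < N)%N ->
  (forall i, 0 <= c i 0) -> (forall i, 0 <= d i 0) -> 0 <= C ->
  (forall i j : 'I_n, j = i.+1 :> nat -> d j 0 - d i 0 <= c j 0) ->
  compact U -> (forall j, U (uh j)) -> 0 < eps ->
  (forall rho beta s, feas rho beta s <-> Sched T s /\ 0 <= rho /\
     forall j u, U u -> fopt c d C s u <= beta j + rho * pcost p (u - uh j)) ->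
  (forall rho beta, obj rho beta = eps `^ p * rho + N%:R^-1 * \sum_(j < N) beta j) ->
  let z' := ereal_inf [set r | exists rho beta s,
     feas rho beta s /\ r = (obj rho beta)%:E] in
  Zhat p eps T c d C U uh = z' /\
  forall s, wdras_opt p eps T c d C U uh s <->
    exists rho beta, feas rho beta s /\ (obj rho beta)%:E = z'.
Proof.
move=> p0 N0 c0 d0 C0 cd cptU Uuh eps0 feasE objE.
have worstE s : worst p eps c d C U uh s =
    ereal_sup [set \int[Q]_u (fopt c d C s u)%:E | Q in ambiguity p eps U uh]%E.
  rewrite /worst; congr ereal_sup; apply: eq_imagel => Q _.
  by apply: eq_integral => u _; rewrite fvalE.
have fc s := @fopt_cont R n c d C s.
have f0 s u := fopt_ge0 s u c0 d0 C0.
apply: joint_min => [rho beta s /feasE[]//|rho beta s /feasE[_ [rho0 fle]]|s Fs].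
  rewrite worstE objE; apply: ge_ereal_sup => _ [Q Qamb <-].
  apply: (wass_dual_le p0 N0 (fc s) (f0 s)) Qamb rho0 fle => //; last exact: ltW.
  by apply: compact_closed => //; exact: norm_hausdorff.
have [rho [beta [rho0 fle le]]] := wass_dual_ge p0 N0 (fc s) (f0 s) cptU Uuh eps0.
by exists rho, beta; split; [exact/feasE | rewrite objE worstE].
Qed.

Theorem theorem3 (R : realType) (n N : nat) (T : R) (c d : 'cV[R]_n) (C : R)
    (U : set 'cV[R]_n) (uh : 'I_N -> 'cV[R]_n) (eps : R) :
  (1 <= n)%N -> (1 <= N)%N -> 0 < T ->
  (forall i, 0 <= c i 0) -> (forall i, 0 <= d i 0) -> 0 <= C ->
  (forall i j : 'I_n, j = i.+1 :> nat -> d j 0 - d i 0 <= c j 0) ->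
  U !=set0 -> compact U -> convex_set (U : set (convex_lmodType 'cV[R]_n)) ->
  (forall j, U (uh j)) -> 0 < eps ->
  (* (i) p = 1 *)
  (Zhat 1 eps T c d C U uh = prog1_val eps T c d C U uh /\
   forall s, wdras_opt 1 eps T c d C U uh s <-> prog1_opt eps T c d C U uh s)
  /\
  (* (ii) p = 2 *)
  (Zhat 2 eps T c d C U uh = prog2_val eps T c d C U uh /\
   forall s, wdras_opt 2 eps T c d C U uh s <-> prog2_opt eps T c d C U uh s).
Proof.
move=> _ N0 _ c0 d0 C0 cd _ cptU _ Uuh eps0; split;
  apply: wdras_reformulation => // rho beta.
- move=> s; split => -[Ss [rho0 h]]; do 2!split => //.
    by move=> j; apply/(COP_K1 U c0 d0 C0 cd (uh j) s (beta j) rho0).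
  by move=> j; apply/(COP_K1 U c0 d0 C0 cd (uh j) s (beta j) rho0); exact: h.
- by rewrite powRr1 // ltW.
- move=> s; split => -[Ss [rho0 h]]; do 2!split => //.
    by move=> j; apply/(COP_K2 U c0 d0 C0 cd (uh j) s rho (beta j)).
  by move=> j; apply/(COP_K2 U c0 d0 C0 cd (uh j) s rho (beta j)); exact: h.
- by rewrite powR_mulrn // ltW.
Qed.
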